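(* Let $I_k,R_k,L_k\ge 1$ be integers with $I_k+R_k-1=L_k$, let $n_{k1}<n_{k2}<\dots<n_{kL_k}$ be integers, put $n_{k,\max}=n_{kL_k}$, and let $\mathbf n_k=[\,n_{k,\max}-n_{kL_k},\dots,n_{k,\max}-n_{k1}\,]^T$. The delays $\boldsymbol x_k=[\kappa_{k1},\dots,\kappa_{kI_k},\mu_{k1},\dots,\mu_{kR_k}]^T$ are designed to satisfy $\mathbf V_k\mathbf Q_k\boldsymbol x_k=\mathbf n_k$, where $\mathbf V_k$ is the given selection matrix for which $$\mathbf V_k\mathbf Q_k=\begin{bmatrix}\mathbf B_1&\mathbf I_{R_k}\\ \bar{\mathbf B}_{I_k}&\mathbf B_{R_k}\end{bmatrix}$$ (with the blocks defined in the context). With this selection matrix, the values of the delay post-compensation and pre-compensation are $$\mu_{k(L_k+1-l)}=n_{k,\max}-n_{kl},\qquad l\in[L_k-R_k+1,\,L_k],$$ and $$\kappa_{k(I_k+1-l)}=n_{kI_k}-n_{kl},\qquad l\in[1,\,L_k-R_k+1],$$ respectively.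
   Context: The index $k$ is a fixed user index; $\kappa_{ki}$ ($1\le i\le I_k$) are the pre-compensation delays introduced at the transmitter, $\mu_{kr}$ ($1\le r\le R_k$) the post-compensation delays introduced at the receiver, and $n_{kl}$ ($1\le l\le L_k$) the integer channel path delays of user $k$. Intervals such as $[1,L_k-R_k+1]$ denote ranges of integers. The matrix $\mathbf Q_k$ is the $I_kR_k\times(I_k+R_k)$ matrix obtained by stacking vertically, for $i=1,\dots,I_k$, the blocks $[\mathbf B_i\ \ \mathbf I_{R_k}]$, where $\mathbf B_i$ is the $R_k\times I_k$ matrix whose $i$-th column is the all-ones vector and whose other entries are zero, and $\mathbf I_{R_k}$ is the identity matrix. Thus the entry of $\mathbf Q_k\boldsymbol x_k$ in position $(i-1)R_k+r$ is $\kappa_{ki}+\mu_{kr}$. The selection matrix $\mathbf V_k$ is the $L_k\times(I_kR_k)$ $0/1$ matrix that selects, in order, all $R_k$ rows of the first block $[\mathbf B_1\ \ \mathbf I_{R_k}]$ and then the last row of each block $[\mathbf B_i\ \ \mathbf I_{R_k}]$ for $i=2,\dots,I_k$. Accordingly, $\bar{\mathbf B}_{I_k}=[\mathbf 0_{(I_k-1)\times 1},\ \mathbf I_{I_k-1}]$ is $(I_k-1)\times I_k$, and $\mathbf B_{R_k}$ in the lower right block is the $(I_k-1)\times R_k$ matrix whose $R_k$-th (last) column is all ones and whose other entries are zero.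
   Formalization: The delays are additionally assumed nonnegative: the system fixes them only up to adding t to every pre-compensation delay and subtracting t from every post-compensation delay (e.g. I=R=L=1, κ=1, μ=-1), so the stated values are not forced without this. *)

(* Defs.v *)
From mathcomp Require Import all_boot all_order all_algebra.

Set Implicit Arguments.
Unset Strict Implicit.
Unset Printing Implicit Defensive.

Import Order.TTheory GRing.Theory Num.Theory.
Local Open Scope ring_scope.

(* Paths, delays, blocks and columns are numbered from 1 by natural numbers;
   only matrix indices are (0-based) ordinals.  The user index is fixed, hence
   omitted.  The matrices have entries in an arbitrary realDomainType, which
   covers both integer-valued and real-valued delays. *)

Definition ones_col (D : realDomainType) (m n c : nat) : 'M[D]_(m, n) :=
  \matrix_(i < m, j < n) (j.+1 == c)%:R.

Lemma ltn_modS (m p : nat) (a : 'I_(m * p)) : (a %% p < p)%N.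
Proof. by rewrite ltn_mod; case: p a => // -[a]; rewrite muln0. Qed.

(* [A 1; ...; A m], one block above the other *)
Definition vstack (D : realDomainType) (m p n : nat)
    (A : nat -> 'M[D]_(p, n)) : 'M[D]_(m * p, n) :=
  \matrix_(a < m * p, j < n) A (a %/ p).+1 (Ordinal (ltn_modS a)) j.

Definition Qmx (D : realDomainType) (I R : nat) : 'M[D]_(I * R, I + R) :=
  vstack I (fun i => row_mx (ones_col D R I i) 1%:M).

(* The s-th selected row: rows 1, ..., R form the first block, and row i * R is
   the last one of block i, which is selected at position s = R + (i - 1). *)
Definition selected_row (R s : nat) : nat :=
  if (s <= R)%N then s else ((s - R + 1) * R)%N.

Definition Vmx (D : realDomainType) (I R L : nat) : 'M[D]_(L, I * R) :=
  \matrix_(s < L, a < I * R) (a.+1 == selected_row R s.+1)%:R.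

Definition Bbar (D : realDomainType) (I : nat) (hI : (1 <= I)%N) :
    'M[D]_(I - 1, I) :=
  castmx (erefl, subnKC hI)
    (row_mx (0 : 'M[D]_(I - 1, 1)) (1%:M : 'M[D]_(I - 1))).

Lemma row_count (I R L : nat) :
  (1 <= I)%N -> (I + R - 1 = L)%N -> (R + (I - 1) = L)%N.
Proof. by move=> hI <-; rewrite addnBA // addnC. Qed.

Definition VQblock (D : realDomainType) (I R L : nat) (hI : (1 <= I)%N)
    (hL : (I + R - 1 = L)%N) : 'M[D]_(L, I + R) :=
  castmx (row_count hI hL, erefl)
    (block_mx (ones_col D R I 1)   1%:M
              (Bbar D hI)          (ones_col D (I - 1) R R)).

Definition delay_vec (D : realDomainType) (I R : nat) (kappa mu : nat -> D) :
    'cV[D]_(I + R) :=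
  col_mx (\col_(i < I) kappa i.+1) (\col_(r < R) mu r.+1).

(* The entry with 0-based index j is n_max - n_(L - j), where n_max = n_L. *)
Definition path_vec (D : realDomainType) (L : nat) (n : nat -> int) :
    'cV[D]_L :=
  \col_(j < L) (n L - n (L - j)%N)%:~R.

(* A delay is nonnegative.  Without this the system, which has I + R unknowns
   but only I + R - 1 equations, determines the kappa_i and mu_r only up to the
   shift kappa_i + t, mu_r - t. *)
Definition nonneg_delays (D : realDomainType) (I R : nat)
    (kappa mu : nat -> D) : Prop :=
  (forall i : nat, (1 <= i <= I)%N -> 0 <= kappa i) /\
  (forall r : nat, (1 <= r <= R)%N -> 0 <= mu r).

(* Main.v *)
Require Import Defs.
From mathcomp Require Import all_boot all_order all_algebra.
From mathcomp Require Import zify ring.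

Set Implicit Arguments.
Unset Strict Implicit.
Unset Printing Implicit Defensive.

Import Order.TTheory GRing.Theory Num.Theory.
Local Open Scope ring_scope.

(* The row selected at the 0-based position s reads kappa_i + mu_r with
   i = s - (R - 1) and r = min(s, R - 1), both 0-based, the subtraction being
   truncated.  The row s = 0 gives kappa_1 + mu_1 = n_max - n_L = 0, so that
   nonnegativity forces kappa_1 = mu_1 = 0.  The rows s < R then give mu, in
   particular mu_R = n_L - n_I, and the rows s >= R give kappa. *)

(** In this form the 0-based index is split by division by [R]: the quotient [s - R.-1] is the block
    and the remainder [minn s R.-1] the row inside it. Truncated subtraction merges the two cases of
    [selected_row]. *)
Lemma selected_rowE (R s : nat) : (0 < R)%N ->
  selected_row R s.+1 = ((s - R.-1) * R + minn s R.-1).+1.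
Proof.
case: R => // R _; rewrite /selected_row /=.
case: ltnP => hs; first by rewrite (_ : s - R = 0)%N; lia.
have [k ->] : exists k, s = (R + k.+1)%N by exists (s - R.+1)%N; lia.
have -> : ((R + k.+1).+1 - R.+1 + 1 = k.+2)%N by lia.
have -> : (R + k.+1 - R = k.+1)%N by lia.
have -> : minn (R + k.+1) R = R by lia.
lia.
Qed.

Lemma Vmx_mulE (D : realDomainType) (I R L p : nat) (A : 'M[D]_(I * R, p))
    (s : 'I_L) (a : 'I_(I * R)) (j : 'I_p) :
  a.+1 = selected_row R s.+1 -> (Vmx D I R L *m A) s j = A a j.
Proof.
move=> ha; rewrite mxE (bigD1 a) //= big1 ?addr0; last first.
  move=> b /negPf neq_ba; rewrite mxE -ha eqSS.
  by rewrite (inj_eq val_inj) neq_ba mul0r.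
by rewrite mxE ha eqxx mul1r.
Qed.

(** An explicit row serves twice: to compare the product with the block matrix, and to evaluate the
    system one equation at a time. *)
Lemma VQE (D : realDomainType) (I R L : nat) (s : 'I_L) :
    (0 < I)%N -> (0 < R)%N -> (I + R - 1 = L)%N ->
  row s (Vmx D I R L *m Qmx D I R) =
    row_mx (\row_(i < I) (i == s - R.-1 :> nat)%N%:R)
           (\row_(r < R) (r == minn s R.-1 :> nat)%N%:R).
Proof.
move=> I0 R0 hL; have ltsL := ltn_ord s.
have lt_r : (minn s R.-1 < R)%N by lia.
have lt_i : (s - R.-1 < I)%N by lia.
have lt_a : ((s - R.-1) * R + minn s R.-1 < I * R)%N.
  by apply: leq_trans (leq_mul lt_i (leqnn R)); rewrite mulSnr ltn_add2l.
apply/rowP => j.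
rewrite mxE (@Vmx_mulE _ _ _ _ _ _ _ (Ordinal lt_a)); last first.
  by rewrite selected_rowE.
rewrite mxE /= divnMDl // divn_small // addn0.
case: (split_ordP j) => k ->; rewrite ?row_mxEl ?row_mxEr !mxE ?eqSS //.
by congr (_%:R); rewrite -(inj_eq val_inj) /= modnMDl modn_small // eq_sym.
Qed.

Lemma VQblockE (D : realDomainType) (I R L : nat) (hI : (1 <= I)%N)
    (hL : (I + R - 1 = L)%N) (s : 'I_L) : (0 < R)%N ->
  row s (VQblock D hI hL) =
    row_mx (\row_(i < I) (i == s - R.-1 :> nat)%N%:R)
           (\row_(r < R) (r == minn s R.-1 :> nat)%N%:R).
Proof.
move=> R0; apply/rowP => j; rewrite mxE castmxE cast_ord_id.
(* Recording that the cast keeps the value lets the split replace [s] by [t] in the upper blocks and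
   by [R + t] in the lower ones. *)
have: cast_ord (esym (row_count hI hL)) s = s :> nat by [].
case: (split_ordP (cast_ord (esym (row_count hI hL)) s)) => t -> /= <-;
  have ltt := ltn_ord t; case: (split_ordP j) => k ->.
- rewrite block_mxEul row_mxEl !mxE; congr (nat_of_bool _)%:R; lia.
- rewrite block_mxEur row_mxEr !mxE -(inj_eq val_inj) /=.
  congr (nat_of_bool _)%:R; lia.
- rewrite block_mxEdl row_mxEl castmxE cast_ord_id mxE.
  have: cast_ord (esym (subnKC hI)) k = k :> nat by [].
  case: (split_ordP (cast_ord (esym (subnKC hI)) k)) => u -> /= <-.
    (* The zero column of [Bbar] fits: a lower row has [s >= R], so [s - R.-1] is positive. *)
    rewrite row_mxEl !mxE (ord1 u) /= (_ : (_ == _) = false) //; lia.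
  rewrite row_mxEr !mxE -(inj_eq val_inj) /=; congr (nat_of_bool _)%:R; lia.
- rewrite block_mxEdr row_mxEr !mxE; have := ltn_ord k => ltk.
  congr (nat_of_bool _)%:R; lia.
Qed.

Lemma sum_delta (D : pzSemiRingType) (m k : nat) (f : nat -> D) : (k < m)%N ->
  \sum_(i < m) (i == k :> nat)%N%:R * f i = f k.
Proof.
move=> ltkm; rewrite (bigD1 (Ordinal ltkm)) //= eqxx mul1r big1 ?addr0 //.
by move=> i; rewrite -(inj_eq val_inj) /= => /negPf ->; rewrite mul0r.
Qed.

Lemma VQ_delayE (D : realDomainType) (I R L : nat) (kappa mu : nat -> D)
    (s : 'I_L) : (0 < I)%N -> (0 < R)%N -> (I + R - 1 = L)%N ->
  (Vmx D I R L *m Qmx D I R *m delay_vec I R kappa mu) s 0 =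
    kappa (s - R.-1).+1%N + mu (minn s R.-1).+1.
Proof.
move=> I0 R0 hL; have ltsL := ltn_ord s.
set M := _ *m Qmx _ _ _.
have -> : (M *m delay_vec I R kappa mu) s 0 =
          (row s M *m delay_vec I R kappa mu) 0 0.
  by rewrite -row_mul [RHS]mxE.
rewrite VQE // mul_row_col !mxE.
under eq_bigr do rewrite !mxE.
under [X in _ + X]eq_bigr do rewrite !mxE.
rewrite (sum_delta (fun i => kappa i.+1)); last by lia.
by rewrite (sum_delta (fun r => mu r.+1)) //; lia.
Qed.

Theorem proposition1 (D : realDomainType) (I R L : nat)
  (hI : (1 <= I)%N) (hR : (1 <= R)%N) (hL1 : (1 <= L)%N)
  (hL : (I + R - 1 = L)%N)
  (n : nat -> int)
  (hn : forall l l' : nat, (1 <= l)%N -> (l < l')%N -> (l' <= L)%N ->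
          n l < n l') :
  Vmx D I R L *m Qmx D I R = VQblock D hI hL /\
  forall kappa mu : nat -> D,
    (nonneg_delays I R kappa mu /\
     Vmx D I R L *m Qmx D I R *m delay_vec I R kappa mu = path_vec D L n)
    <->
    ((forall l : nat, (L - R + 1 <= l <= L)%N ->
        mu (L + 1 - l)%N = (n L - n l)%:~R) /\
     (forall l : nat, (1 <= l <= L - R + 1)%N ->
        kappa (I + 1 - l)%N = (n I - n l)%:~R)).
Proof.
split; first by apply/row_matrixP => s; rewrite VQE // VQblockE.
move=> kappa mu; split=> [[[kappa_ge0 mu_ge0] sys] | [mu_def kappa_def]].
- have row_eq s : (s < L)%N ->
      kappa (s - R.-1).+1 + mu (minn s R.-1).+1 = (n L - n (L - s)%N)%:~R.
    move=> ltsL; have /matrixP/(_ (Ordinal ltsL) 0) := sys.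
    by rewrite VQ_delayE // mxE.
  have kappa1 : kappa 1%N = 0.
    have := row_eq 0%N hL1; rewrite sub0n min0n subn0 subrr => /eqP.
    by rewrite paddr_eq0 ?kappa_ge0 ?mu_ge0 ?hI ?hR // => /andP[/eqP].
  have mu_eq l : (L - R + 1 <= l <= L)%N -> mu (L + 1 - l)%N = (n L - n l)%:~R.
    move=> hl; have := row_eq (L - l)%N ltac:(lia).
    have -> : (L - l - R.-1 = 0)%N by lia.
    have -> : (minn (L - l) R.-1).+1 = (L + 1 - l)%N by lia.
    have -> : (L - (L - l) = l)%N by lia.
    by rewrite kappa1 add0r.
  (* Since L - R + 1 = I, the two ranges meet at [l = I], where the claim is kappa_1 = 0. *)
  split=> // l hl; have [->|neq_lI] := eqVneq l I.
    by rewrite subrr addKn kappa1.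
  (* For [l < I] the row pairs kappa_(I+1-l) with mu_R, whose index is R = L + 1 - I; its value n_L
     - n_I is then cancelled. *)
  have := row_eq (L - l)%N ltac:(lia).
  have -> : (L - l - R.-1).+1 = (I + 1 - l)%N by lia.
  have -> : (minn (L - l) R.-1).+1 = (L + 1 - I)%N by lia.
  have -> : (L - (L - l) = l)%N by lia.
  rewrite mu_eq; last by lia.
  by rewrite !rmorphB /= => e; apply: (addIr ((n L)%:~R - (n I)%:~R));
    rewrite e; ring.
(* Conversely, monotonicity of [n] makes the prescribed delays nonnegative. *)
- have n_le l l' : (1 <= l)%N -> (l <= l')%N -> (l' <= L)%N -> n l <= n l'.
    move=> l1; rewrite leq_eqVlt => /predU1P[->//|ltll] l'L.
    exact/ltW/hn.
  have muE r : (1 <= r <= R)%N -> mu r = (n L - n (L + 1 - r)%N)%:~R.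
    move=> hr; rewrite -mu_def; last by lia.
    by congr mu; lia.
  have kappaE i : (1 <= i <= I)%N -> kappa i = (n I - n (I + 1 - i)%N)%:~R.
    move=> hi; rewrite -kappa_def; last by lia.
    by congr kappa; lia.
  split; first split=> [i hi|r hr].
  + by rewrite kappaE // ler0z subr_ge0 n_le //; lia.
  + by rewrite muE // ler0z subr_ge0 n_le //; lia.
  apply/colP => s; have ltsL := ltn_ord s.
  rewrite VQ_delayE // mxE kappaE ?muE; [|lia..].
  rewrite -rmorphD /=; congr (_%:~R).
  (* In both cases n_I cancels: for [s < R] inside kappa_1 = n_I - n_I, otherwise between kappa and
     mu_R = n_L - n_I. *)
  have [ltsR|leRs] := ltnP s R.
    have -> : (I + 1 - (s - R.-1).+1 = I)%N by lia.
    have -> : (L + 1 - (minn s R.-1).+1 = L - s)%N by lia.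
    ring.
  have -> : (I + 1 - (s - R.-1).+1 = L - s)%N by lia.
  have -> : (L + 1 - (minn s R.-1).+1 = I)%N by lia.
  ring.
Qed.
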